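(* Let $n\ge1$, $m\ge2$ be integers and let $T_1,\ldots,T_n\in B(\mathcal H)$ be such that $T_\alpha=0$ for any $\alpha\in\mathbb F_n^+$ with $|\alpha|=m$. Then $$w(T_\alpha:\ |\alpha|=k)\le\left\|\sum_{i=1}^nT_iT_i^*\right\|^{k/2}\cos\frac{\pi}{\left[\frac{m-1}k\right]+2}$$ for $1\le k\le m-1$. If, in addition, $[T_1,\ldots,T_n]$ is a row contraction and $p:=\sum_{|\alpha|\le m-1}a_\alpha e_\alpha$ is a polynomial, then $$w\big(p(T_1,\ldots,T_n)\big)\le K\|p\|_2,\qquad K:=\left(\sum_{k=0}^{m-1}\cos^2\frac{\pi}{\left[\frac{m-1}k\right]+2}\right)^{1/2},$$ where, by convention, the term corresponding to $k=0$ in the sum defining $K$ is $1$.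
   Context: $\mathcal H$ is a complex Hilbert space. $[x]$ is the integer part of $x$. $\mathbb F_n^+$ is the unital free semigroup on $g_1,\ldots,g_n$ with identity $g_0$; for $\alpha=g_{i_1}\cdots g_{i_k}$, $|\alpha|=k$, $T_\alpha=T_{i_1}\cdots T_{i_k}$; $T_{g_0}=I$. Polynomials $p=\sum a_\alpha e_\alpha$ are finite linear combinations of the orthonormal basis $\{e_\alpha\}_{\alpha\in\mathbb F_n^+}$ of the full Fock space, $\|p\|_2=(\sum|a_\alpha|^2)^{1/2}$, $p(T_1,\ldots,T_n)=\sum a_\alpha T_\alpha$. Row contraction: $\sum T_iT_i^*\le I$. Joint numerical radius of $(X_1,\ldots,X_d)\in B(\mathcal H)^{(d)}$: $w(X_1,\ldots,X_d):=\sup\left|\sum_{\beta\in\mathbb F_d^+}\sum_{j=1}^d\langle h_\beta,X_jh_{g_j\beta}\rangle\right|$ over all families $\{h_\beta\}_{\beta\in\mathbb F_d^+}\subset\mathcal H$ with $\sum_\beta\|h_\beta\|^2=1$ (for $d=1$ this is the usual numerical radius). $w(T_\alpha:|\alpha|=k)$ is the joint numerical radius of the $n^k$-tuple of all $T_\alpha$ with $|\alpha|=k$ (in any order). *)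

(* Defs.v *)
From mathcomp Require Import all_boot all_order all_algebra finmap.
From mathcomp Require Import boolp classical_sets reals ereal topology normedtype.
From mathcomp Require Import esum exp trigo.
From mathcomp.analysis.showcase Require summability.
From mathcomp.real_closed Require Import complex.

Set Implicit Arguments.
Unset Strict Implicit.
Unset Printing Implicit Defensive.

Import Order.TTheory GRing.Theory Num.Theory.
Import numFieldNormedType.Exports.

Local Open Scope classical_set_scope.
Local Open Scope ring_scope.

(* Norms of a normed space over R[i] are real elements of R[i]; this is the
   same number in R. *)
Definition rnorm (R : realType) (V : normedModType R[i]) (x : V) : R :=
  complex.Re `|x|.

(* A complete normed space whose norm is induced by dot is a Hilbert space; dot
   is linear in its first argument. *)
Definition induces_norm (R : realType) (H : normedModType R[i])
    (dot : {dot H for Num.conj}) : Prop :=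
  forall x, `|x| ^+ 2 = dot x x.

Definition bounded_op (R : realType) (H : normedModType R[i])
    (A : {linear H -> H}) : Prop :=
  bounded_near A (nbhs (0 : H)).

Definition opnorm (R : realType) (H : normedModType R[i]) (A : H -> H) : R :=
  sup [set rnorm (A x) | x in [set x : H | `|x| <= 1]].

(* A^* y is the vector representing the functional x |-> dot (A x) y; for a
   bounded A on a Hilbert space it exists and is unique by the Riesz theorem. *)
Definition adjoint (R : realType) (H : normedModType R[i])
    (dot : {dot H for Num.conj}) (A : H -> H) (y : H) : H :=
  get [set z | forall x, dot (A x) y = dot x z].

Definition row_square (R : realType) (H : normedModType R[i])
    (dot : {dot H for Num.conj}) (n : nat) (T : 'I_n -> {linear H -> H})
    (x : H) : H :=
  \sum_(i < n) T i (adjoint dot (T i) x).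

Definition row_contraction (R : realType) (H : normedModType R[i])
    (dot : {dot H for Num.conj}) (n : nat) (T : 'I_n -> {linear H -> H}) :
    Prop :=
  forall x, dot (row_square dot T x) x <= dot x x.

(* The free semigroup on I is the set of words seq I, with g_0 = [::] and
   g_j b = j :: b. *)
Definition word_op (R : realType) (H : normedModType R[i]) (I : Type)
    (T : I -> {linear H -> H}) (w : seq I) : H -> H :=
  foldr (fun i A => T i \o A) idfun w.

(* The tuple is indexed by an arbitrary finite type I, as the order of its
   entries is irrelevant; the sum over words is unconditional (it converges
   absolutely when the X j are bounded). *)
Definition joint_numrad (R : realType) (H : normedModType R[i])
    (dot : {dot H for Num.conj}) (I : finType) (X : I -> H -> H) : \bar R :=
  ereal_sup
    [set (rnorm (summability.sum (fun b : seq I =>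
            (\sum_(j : I) dot (h b) (X j (h (j :: b)))) : R[i]^o)))%:E
    | h in [set h : seq I -> H |
              (\esum_(b in [set: seq I]) (rnorm (h b) ^+ 2)%:E = 1)%E]].

(* The case d = 1 of the joint numerical radius. *)
Definition numrad (R : realType) (H : normedModType R[i])
    (dot : {dot H for Num.conj}) (A : H -> H) : \bar R :=
  joint_numrad dot (fun _ : 'I_1 => A).

(* Polynomials sum_w a_w e_w of the full Fock space, given by their
   coefficients. *)
Definition fock_poly (R : realType) (n : nat) :=
  {fsfun seq 'I_n -> R[i] with 0}.

Definition poly_op (R : realType) (H : normedModType R[i]) (n : nat)
    (p : fock_poly R n) (T : 'I_n -> {linear H -> H}) (x : H) : H :=
  \sum_(w <- finsupp p) p w *: word_op T w x.

Definition poly_norm2 (R : realType) (n : nat) (p : fock_poly R n) : R :=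
  Num.sqrt (\sum_(w <- finsupp p) rnorm (p w : R[i]^o) ^+ 2).

Definition cosk (R : realType) (m k : nat) : R :=
  cos (pi / ((m - 1) %/ k + 2)%:R).

(* The term k = 0 is set apart, as division by 0 in nat would make it 0. *)
Definition constK (R : realType) (m : nat) : R :=
  Num.sqrt (\sum_(0 <= k < m) (if k == 0%N then 1 else cosk R m k ^+ 2)).

(* Main.v *)
(* On families (h_b) indexed by words put (Y h)_b = sum_j X_j h_(jb); the sum
   defining the joint numerical radius is <h, Y h>, Y inherits the row norm of
   the tuple, and Y^N = 0 as soon as the products of N entries vanish.  So the
   first bound is the Haagerup-de la Harpe inequality
   |<Y h, h>| <= cos (pi / (N + 1)) ||h||^2 for one contraction with Y^N = 0.
   With the defect form D(a, b) = <a, b> - <Y a, Y b>, which is positive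
   semidefinite, telescoping gives <Y h, h> = sum_j D(Y^(j+1) h, Y^j h) and
   ||h||^2 = sum_j D(Y^j h, Y^j h), so that the inequality reduces to the norm
   of the path on N vertices, whose positive eigenvector is sin (j pi / (N + 1)).
   Truncating h to words of bounded length makes all sums finite.
   For a polynomial, the same inequality applies to each homogeneous part
   sum_(|w| = k) a_w T_w, which has norm at most (sum_(|w| = k) |a_w|^2)^(1/2)
   and is nilpotent; Cauchy-Schwarz over k concludes. *)
From HB Require Import structures.
Require Import Defs.
From mathcomp Require Import all_boot all_order all_algebra finmap.
From mathcomp Require Import boolp classical_sets reals ereal topology normedtype.
From mathcomp Require Import esum exp trigo.
From mathcomp Require Import functions cardinality fsbigop.
From mathcomp.real_closed Require Import complex.
From mathcomp Require Import ring lra.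

Set Implicit Arguments.
Unset Strict Implicit.
Unset Printing Implicit Defensive.

Import Order.TTheory GRing.Theory Num.Theory.
Import numFieldNormedType.Exports.

Local Open Scope classical_set_scope.
Local Open Scope ring_scope.

(** * Positive semidefinite forms and the weighted arithmetic-geometric inequality *)

Section psd_form.
Variables (C : numClosedFieldType) (V : lmodType C) (B : V -> V -> C).
Hypothesis Bl : forall w a u v, B (a *: u + v) w = a * B u w + B v w.
Hypothesis BC : forall u v, B u v = (B v u)^*.
Hypothesis B0 : forall u, 0 <= B u u.

Lemma psd_form_0l v : B 0 v = 0.
Proof.
by have := Bl v (-1) 0 0; rewrite scaler0 addr0 mulN1r addNr.
Qed.

Lemma psd_form_Br w a u v : B w (u - a *: v) = B w u - a^* * B w v.
Proof.
rewrite (BC w) addrC -scaleNr Bl (BC w u) (BC w v).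
by rewrite rmorphD rmorphM rmorphN mulNr addrC.
Qed.

Lemma psd_form_Bl w a u v : B (u - a *: v) w = B u w - a * B v w.
Proof. by rewrite addrC -scaleNr Bl mulNr addrC. Qed.

(** When [B u v] is nonzero, expand [B x x >= 0] at [x = v - (t * w) *: u], where the unimodular
    phase [w] turns [B u v] into its modulus, and divide by [t]. *)
Lemma psd_form_amgm t u v : 0 < t ->
  2 * `|B u v| <= t * B u u + t^-1 * B v v.
Proof.
move=> t0; have [->|c0] := eqVneq (B u v) 0.
  rewrite normr0 mulr0 addr_ge0// mulr_ge0// ?invr_ge0; exact: ltW.
pose w := (B u v)^* / `|B u v|.
have nc : `|B u v| != 0 by rewrite normr_eq0.
have wc : w * w^* = 1.
  rewrite -normCK /w normrM normfV norm_conjC normr_id divff// expr1n//.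
have tr : (t * w)^* = t * w^* by rewrite rmorphM /= (geC0_conj (ltW t0)).
have := B0 (v - (t * w) *: u).
rewrite psd_form_Bl !psd_form_Br (BC v u) tr.
have e1 : w * B u v = `|B u v|.
  by rewrite /w mulrAC -[_^* * _]mulrC -normCK expr2 mulfK.
have e2 : w^* * (B u v)^* = `|B u v|.
  by rewrite -rmorphM e1 /= conj_normC.
have -> : B v v - t * w^* * (B u v)^* - t * w * (B u v - t * w^* * B u u) =
  B v v - t * (w^* * (B u v)^*) - t * (w * B u v) + t * t * (w * w^*) * B u u.
  by ring.
rewrite wc e1 e2 mulr1 => h.
rewrite -(ler_pM2l t0) mulrDr (mulrA t t^-1) divff ?gt_eqF// mul1r -subr_ge0.
by apply: le_trans h _; rewrite le_eqVlt; apply/orP; left; apply/eqP; ring.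
Qed.

End psd_form.

(** * The Haagerup-de la Harpe inequality for a nilpotent contraction *)

Section nilpotent_contraction.
Variables (C : numClosedFieldType) (V : lmodType C) (B : V -> V -> C).
Hypothesis Bl : forall w a u v, B (a *: u + v) w = a * B u w + B v w.
Hypothesis BC : forall u v, B u v = (B v u)^*.
Hypothesis B0 : forall u, 0 <= B u u.
Variable A : {linear V -> V}.
Hypothesis A_contr : forall u, B (A u) (A u) <= B u u.

Let D u v := B u v - B (A u) (A v).

Let Dl w a u v : D (a *: u + v) w = a * D u w + D v w.
Proof. by rewrite /D linearP !Bl; ring. Qed.

Let DC u v : D u v = (D v u)^*.
Proof. by rewrite /D rmorphB /= -!BC. Qed.

Let D0 u : 0 <= D u u.
Proof. by rewrite subr_ge0. Qed.

(** Here [s] is a positive eigenvector, with eigenvalue [2 * k], of the path on the vertices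
    [1, ..., N.+1]; its zeros at [0] and [N.+2] encode the two ends. Its ratios are the weights with
    which the inequality for [D] is applied to each edge. *)
Lemma nilpotent_contraction_numrad (N : nat) (s : nat -> C) (k : C) h :
  s 0%N = 0 -> s N.+2 = 0 -> (forall j, (j <= N)%N -> 0 < s j.+1) ->
  (forall j, (j <= N)%N -> s j + s j.+2 = 2 * k * s j.+1) ->
  iter N.+1 A h = 0 -> `|B (A h) h| <= k * B h h.
Proof.
move=> s0 sN sgt0 sE ANh.
have [u [uh uS uN]] : exists u, [/\ u 0%N = h, forall j, A (u j) = u j.+1 &
  u N.+1 = 0] by exists (fun j => iter j A h).
have uN1 : u N.+2 = 0 by rewrite -uS uN linear0.
have e1 : B h h = \sum_(j < N.+1) D (u j) (u j).
  rewrite (eq_bigr (fun j : 'I_N.+1 => - (B (u j.+1) (u j.+1) - B (u j) (u j)))).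
    rewrite sumrN -(big_mkord predT (fun j => B (u j.+1) (u j.+1) - B (u j) (u j))).
    by rewrite telescope_sumr// uN (psd_form_0l Bl) sub0r opprK ?uh.
  by move=> j _; rewrite opprB /D !uS.
have e2 : B (A h) h = \sum_(j < N) D (u j.+1) (u j).
  (* The added term [j = N] is zero because [u N.+1 = 0]; with it the sum telescopes to
     [B (u 1) (u 0)]. *)
  have -> : \sum_(j < N) D (u j.+1) (u j) = \sum_(j < N.+1) D (u j.+1) (u j).
    have DN : D (u N.+1) (u N) = 0 by rewrite uN /D linear0 !(psd_form_0l Bl) subr0.
    by rewrite big_ord_recr/= DN addr0.
  rewrite (eq_bigr (fun j : 'I_N.+1 => - (B (u j.+2) (u j.+1) - B (u j.+1) (u j)))).
    rewrite sumrN -(big_mkord predT (fun j => B (u j.+2) (u j.+1) - B (u j.+1) (u j))).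
    by rewrite telescope_sumr// uN1 (psd_form_0l Bl) sub0r opprK ?uh// -uS uh.
  by move=> j _; rewrite opprB /D !uS.
rewrite -(ler_pM2l (ltr0n C 2)) e2.
(* The edge joining [j] and [j.+1] gets the weight [s j.+2 / s j.+1] at one end and its inverse at
   the other. *)
apply: (@le_trans _ _ (\sum_(j < N) (s j.+2 / s j.+1 * D (u j) (u j) +
    s j.+1 / s j.+2 * D (u j.+1) (u j.+1)))).
  apply: (@le_trans _ _ (\sum_(j < N) 2 * `|D (u j.+1) (u j)|)).
    by rewrite -mulr_sumr ler_pM2l ?ltr0n// ler_norm_sum.
  apply: ler_sum => -[j jN] _ /=.
  rewrite DC norm_conjC -[s j.+1 / _]invf_div.
  by apply: psd_form_amgm => //; apply: divr_gt0; apply: sgt0 => //; exact: ltnW.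
rewrite big_split/=.
(* The boundary zeros of [s] let both sums run over all [N.+1] vertices; vertex [j] then carries the
   coefficient [(s j + s j.+2) / s j.+1 = 2 * k]. *)
have -> : \sum_(j < N) s j.+2 / s j.+1 * D (u j) (u j) =
          \sum_(j < N.+1) s j.+2 / s j.+1 * D (u j) (u j).
  by rewrite big_ord_recr/= sN !mul0r addr0.
have -> : \sum_(j < N) s j.+1 / s j.+2 * D (u j.+1) (u j.+1) =
          \sum_(j < N.+1) s j / s j.+1 * D (u j) (u j).
  by rewrite big_ord_recl/= s0 !mul0r add0r.
rewrite -big_split/= mulrA e1 mulr_sumr le_eqVlt; apply/orP; left; apply/eqP.
apply: eq_bigr => -[j jN] _ /=; rewrite -mulrDl -mulrDl addrC sE//.
by rewrite mulfK// gt_eqF// sgt0.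
Qed.

End nilpotent_contraction.

(** * Operators with bound [r], by rescaling *)

Section bounded_operator.
Variables (C : numClosedFieldType) (V : lmodType C) (B : V -> V -> C).
Hypothesis Bl : forall w a u v, B (a *: u + v) w = a * B u w + B v w.
Hypothesis BC : forall u v, B u v = (B v u)^*.
Hypothesis B0 : forall u, 0 <= B u u.
Variables (A : {linear V -> V}) (r : C).
Hypotheses (r0 : 0 < r) (A_bnd : forall u, B (A u) (A u) <= r ^+ 2 * B u u).

Lemma bounded_numrad h : `|B (A h) h| <= r * B h h.
Proof.
have r'0 : 0 < r^-1 by rewrite invr_gt0.
rewrite -(ler_pM2l (ltr0n C 2)).
(* With the weight [r^-1] each of the two terms is at most [r * B h h]. *)
apply: le_trans (psd_form_amgm Bl BC B0 (A h) h r'0) _.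
rewrite invrK mulr_natl mulr2n lerD2r.
by rewrite -(ler_pM2l r0) mulVKf ?gt_eqF// mulrA -expr2.
Qed.

Lemma nilpotent_numrad (N : nat) (s : nat -> C) (k : C) h :
  s 0%N = 0 -> s N.+2 = 0 -> (forall j, (j <= N)%N -> 0 < s j.+1) ->
  (forall j, (j <= N)%N -> s j + s j.+2 = 2 * k * s j.+1) ->
  iter N.+1 A h = 0 -> `|B (A h) h| <= r * k * B h h.
Proof.
move=> s0 sN sgt0 sE ANh.
have BZl a u w : B (a *: u) w = a * B u w.
  by rewrite -[a *: u]addr0 Bl (psd_form_0l Bl) addr0.
have BZr a u w : B w (a *: u) = a^* * B w u by rewrite BC BZl rmorphM/= -BC.
have r'r : (r^-1)^* = r^-1 by apply: geC0_conj; rewrite invr_ge0 ltW.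
have A1 u : B (r^-1 *: A u) (r^-1 *: A u) <= B u u.
  rewrite BZl BZr r'r mulrA -expr2 -(ler_pM2l (exprn_gt0 2 r0)) mulrA.
  by rewrite -exprMn divff ?gt_eqF// expr1n mul1r.
have iterA j u : iter j (r^-1 \*: A) u = r^-1 ^+ j *: iter j A u.
  elim: j => [|j IH]; first by rewrite expr0 scale1r.
  by rewrite !iterS IH /= linearZ scalerA exprS.
have := nilpotent_contraction_numrad Bl BC (A := r^-1 \*: A) A1 s0 sN sgt0 sE.
move=> /(_ h); rewrite iterA ANh scaler0 => /(_ erefl) /=.
have ri0 : 0 <= r^-1 by rewrite invr_ge0 ltW.
rewrite BZl normrM (ger0_norm ri0).
by rewrite -(ler_pM2l r0) mulVKf ?gt_eqF// mulrA.
Qed.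

End bounded_operator.


(** * Sums over words of bounded length *)

Section words.
Variable I : finType.

(** Recursion on the first letter separates the empty word from the words [j :: w], matching the way
    [Y] relates the entries at [w] and at [j :: w]. *)
Fixpoint words (L : nat) : seq (seq I) :=
  if L is L'.+1 then [::] :: [seq j :: w | j <- enum I, w <- words L']
  else [::].

Lemma mem_words L w : (w \in words L) = (size w < L)%N.
Proof.
elim: L w => [|L IH] [|j w]; rewrite ?in_nil ?mem_head//= in_cons/= ltnS -IH.
apply/allpairsP/idP => [[[i v] /= [_ vL [_ ->//]]]|wL].
by exists (j, w); rewrite mem_enum.
Qed.

Lemma words_uniq L : uniq (words L).
Proof.
elim: L => //= L IH; apply/andP; split; first by apply/negP => /allpairsP[[]] ? ? [].
by apply: allpairs_uniq => //; [exact: enum_uniq|move=> [i v] [j w] _ _ /= [-> ->]].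
Qed.

Lemma big_wordsS (V : nmodType) L (f : seq I -> V) :
  \sum_(w <- words L.+1) f w =
  f [::] + \sum_(j : I) \sum_(w <- words L) f (j :: w).
Proof. by rewrite big_cons big_allpairs_dep big_enum. Qed.

Lemma big_words_lt (V : nmodType) L (f : seq I -> V) :
  \sum_(w <- words L.+1 | (size w < L)%N) f w = \sum_(w <- words L) f w.
Proof.
rewrite -big_filter; apply: perm_big; apply: uniq_perm => [||w].
- by rewrite filter_uniq// words_uniq.
- exact: words_uniq.
- by rewrite mem_filter !mem_words; case: (ltnP (size w) L) => //= /ltnW.
Qed.

End words.

(** * The operator Y on families indexed by words *)

Section row_shift.
Variables (R : realType) (H : normedModType R[i]).
Variables (dot : {dot H for Num.conj}) (dotE : induces_norm dot).
Variables (J : finType) (X : J -> {linear H -> H}).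

Lemma word_op_cat (v w : seq J) x :
  word_op X (v ++ w) x = word_op X v (word_op X w x).
Proof. by elim: v => //= i v; rewrite /word_op/= => ->. Qed.

Lemma word_op_is_linear (w : seq J) : linear (word_op X w).
Proof.
elim: w => [|i w IH] c x y //=.
by rewrite /word_op/= -/(word_op X w) IH linearP.
Qed.

HB.instance Definition _ w :=
  GRing.isLinear.Build _ _ _ _ (word_op X w) (word_op_is_linear w).

(** This is [Y] with its values set to zero on words of length at least [L], so that no entry
    depends on words longer than [L]. *)
Definition row_shift (L : nat) (a : seq J -> H) (w : seq J) : H :=
  if (size w < L)%N then \sum_j X j (a (j :: w)) else 0.

Lemma row_shift_is_linear L : linear (row_shift L).
Proof.
move=> c a b; apply/funext => w; rewrite /row_shift.
transitivity (c *: row_shift L a w + row_shift L b w) => //.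
rewrite /row_shift; case: ifP => _; last by rewrite scaler0 addr0.
by rewrite scaler_sumr -big_split/=; apply: eq_bigr => j _; rewrite linearP.
Qed.

HB.instance Definition _ L :=
  GRing.isLinear.Build _ _ _ _ (row_shift L) (row_shift_is_linear L).

(** Each application of [Y] puts one more operator [X j] in front of the entries of [a]. The prefix
    [v] absorbs it, so induction on [q] ends at a product of [N] entries. *)
Lemma word_op_row_shift_iter L q (v w : seq J) (a : seq J -> H) N :
  (forall w, size w = N -> forall x, word_op X w x = 0) -> (size v + q = N)%N ->
  word_op X v (iter q (row_shift L) a w) = 0.
Proof.
move=> Xnil; elim: q v w => [|q IH] v w vq; first by rewrite Xnil// -vq addn0.
rewrite iterS /row_shift -/(row_shift L); case: ifP => _; last first.
  exact: (linear0 (word_op X v)).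
rewrite (linear_sum (word_op X v))/= big1// => j _.
have := IH (rcons v j) (j :: w); rewrite size_rcons addSnnS => /(_ vq).
by rewrite -cats1 word_op_cat.
Qed.

(** Words longer than [L] are ignored, so on the space of all families this form is only
    semidefinite; hence the generality of the abstract inequalities above. *)
Definition words_dot (L : nat) (a b : seq J -> H) : R[i] :=
  \sum_(w <- words J L.+1) dot (a w) (b w).

Lemma words_dot_linear L w c (a b : seq J -> H) :
  words_dot L (c *: a + b) w = c * words_dot L a w + words_dot L b w.
Proof.
rewrite /words_dot mulr_sumr -big_split/=; apply: eq_bigr => v _.
exact: linearPl.
Qed.

Lemma dotC u v : dot u v = (dot v u)^*.
Proof. by rewrite hermC mul1r. Qed.

Lemma words_dotC L a b : words_dot L a b = (words_dot L b a)^*.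
Proof.
by rewrite /words_dot [RHS]rmorph_sum/=; apply: eq_bigr => v _; exact: dotC.
Qed.

Lemma words_dot_ge0 L a : 0 <= words_dot L a a.
Proof. by apply: sumr_ge0 => v _; rewrite -dotE exprn_ge0. Qed.

Lemma words_dotE L a : words_dot L a a = \sum_(w <- words J L.+1) `|a w| ^+ 2.
Proof. by apply: eq_bigr => v _; rewrite dotE. Qed.

Variable r : R[i].
Hypothesis r0 : 0 <= r.
Hypothesis X_bnd : forall g : J -> H,
  `|\sum_j X j (g j)| ^+ 2 <= r ^+ 2 * \sum_j `|g j| ^+ 2.

(** Every nonempty word of length at most [L] is [j :: w] for exactly one [j] and one [w] of length
    below [L], so the row bounds at these [w] add up; the entry at the empty word is slack. *)
Lemma row_shift_bounded L a :
  words_dot L (row_shift L a) (row_shift L a) <= r ^+ 2 * words_dot L a a.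
Proof.
rewrite !words_dotE.
have -> : \sum_(w <- words J L.+1) `|row_shift L a w| ^+ 2 =
          \sum_(w <- words J L) `|\sum_j X j (a (j :: w))| ^+ 2.
  rewrite -[RHS]big_words_lt [RHS]big_mkcond/=; apply: eq_bigr => w _.
  by rewrite /row_shift; case: ifP => // _; rewrite normr0 expr0n.
apply: (@le_trans _ _
    (\sum_(w <- words J L) r ^+ 2 * \sum_j `|a (j :: w)| ^+ 2)).
  exact: ler_sum.
rewrite -mulr_sumr ler_wpM2l ?exprn_ge0// big_wordsS exchange_big/= lerDr.
exact: exprn_ge0.
Qed.

(** The numerical radius has [h] in the first slot, the abstract inequalities in the second; the
    resulting conjugation leaves the modulus unchanged. *)
Lemma row_shift_dot L h :
  \sum_(b <- words J L) \sum_j dot (h b) (X j (h (j :: b))) =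
  (words_dot L (row_shift L h) h)^*.
Proof.
rewrite -words_dotC /words_dot -[LHS]big_words_lt [LHS]big_mkcond/=.
apply: eq_bigr => w _; rewrite /row_shift; case: ifP => _; last by rewrite linear0r.
by rewrite linear_sumr.
Qed.

(** The zero bound is treated apart because rescaling divides by [r]. *)
Let row_shift_numrad0 L h : r = 0 ->
  \sum_(b <- words J L) \sum_j dot (h b) (X j (h (j :: b))) = 0.
Proof.
move=> r_0; rewrite big1_seq// => b _.
rewrite -linear_sumr.
have := X_bnd (fun j => h (j :: b)).
rewrite r_0 expr0n/= mul0r le_eqVlt (le_gtF (exprn_ge0 _ (normr_ge0 _))) orbF.
rewrite expf_eq0/= normr_eq0 => /eqP ->.
exact: linear0r.
Qed.

Lemma row_numrad L h :
  `|\sum_(b <- words J L) \sum_j dot (h b) (X j (h (j :: b)))| <=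
  r * \sum_(b <- words J L.+1) `|h b| ^+ 2.
Proof.
have [r_0|rn0] := eqVneq r 0; first by rewrite row_shift_numrad0// r_0 normr0 mul0r.
rewrite row_shift_dot norm_conjC -words_dotE.
have rgt0 : 0 < r by rewrite lt_def rn0.
exact: (bounded_numrad (words_dot_linear L) (words_dotC L) (words_dot_ge0 L)
  rgt0 (row_shift_bounded L)).
Qed.

Lemma row_numrad_nilpotent (N : nat) (s : nat -> R[i]) (k : R[i]) L h :
  s 0%N = 0 -> s N.+2 = 0 -> (forall j, (j <= N)%N -> 0 < s j.+1) ->
  (forall j, (j <= N)%N -> s j + s j.+2 = 2 * k * s j.+1) ->
  (forall w : seq J, size w = N.+1 -> forall x, word_op X w x = 0) ->
  `|\sum_(b <- words J L) \sum_j dot (h b) (X j (h (j :: b)))| <=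
  r * k * \sum_(b <- words J L.+1) `|h b| ^+ 2.
Proof.
move=> s0 sN sgt0 sE Xnil.
have [r_0|rn0] := eqVneq r 0; first by rewrite row_shift_numrad0// r_0 normr0 !mul0r.
rewrite row_shift_dot norm_conjC -words_dotE.
have rgt0 : 0 < r by rewrite lt_def rn0.
apply: (nilpotent_numrad (words_dot_linear L) (words_dotC L) rgt0
  (row_shift_bounded L) s0 sN sgt0 sE).
apply/funext => w.
exact: (@word_op_row_shift_iter L N.+1 [::] w h N.+1 Xnil erefl).
Qed.

End row_shift.

(** * From finite sums to the joint numerical radius *)

Section numerical_radius_bound.
Variables (R : realType) (H : normedModType R[i]).
Variables (dot : {dot H for Num.conj}).

Lemma rnormE (V : normedModType R[i]) (x : V) : `|x| = (rnorm x)%:C%C.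
Proof. by rewrite /rnorm RRe_real// normr_real. Qed.

Lemma le_rnorm (V : normedModType R[i]) (x : V) (M : R) :
  (rnorm x <= M) = (`|x| <= M%:C%C).
Proof. by rewrite rnormE lecR. Qed.

Lemma rnorm_ge0 (V : normedModType R[i]) (x : V) : 0 <= rnorm x.
Proof. by rewrite -lecR -rnormE; exact: normr_ge0. Qed.

(* If the net of partial sums diverges, its lim is the default value 0. *)
Lemma norm_sum_le (I : finType) (f : seq I -> R[i]^o) (M : R[i]) :
  0 <= M -> (forall L, `|\sum_(b <- words I L) f b| <= M) ->
  `|summability.sum f| <= M.
Proof.
move=> M0 fM; rewrite /summability.sum.
have tF : ProperFilter (@summability.totally (seq I)).
  exact: summability.totally_filter.
set F := (X in lim X).
have [cF|/dvgP ->] := pselect (cvg F); last by rewrite normr0.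
apply/ler_addgt0Pr => e e0.
have /cvgr_dist_le/(_ _ e0) := cF.
move=> [A _ FA].
(* Partial sums over finite sets containing [A] are within [e] of the limit; the words shorter than
   this [L] form such a set. *)
pose L := (\max_(w <- A) size w).+1.
have AL : (A `<=` [fset x in words I L])%fset.
  apply/fsubsetP => w wA; rewrite in_fset mem_words ltnS.
  exact: (leq_bigmax_seq (F := size)).
have -> : lim F = (lim F - \sum_(b <- words I L) f b) + \sum_(b <- words I L) f b.
  by rewrite subrK.
apply: le_trans (ler_normD _ _) _; rewrite addrC lerD//.
have -> : \sum_(b <- words I L) f b =
    summability.partial_sum f [fset x in words I L]%fset.
  rewrite /summability.partial_sum -(big_seq_fsetE _ _ predT f).
  apply: perm_big; apply: uniq_perm => [||w]; [exact: words_uniq|exact: fset_uniq|].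
  by rewrite in_fset.
exact: FA.
Qed.

(** The right-hand sum of the hypothesis reaches one letter further since [h (j :: b)] occurs for
    [b] of length below [L]; for an admissible [h] it is at most the total, which is 1. *)
Lemma joint_numrad_le (J : finType) (X : J -> H -> H) (M : R) :
  0 <= M ->
  (forall (h : seq J -> H) L,
    `|\sum_(b <- words J L) \sum_j dot (h b) (X j (h (j :: b)))| <=
    M%:C%C * \sum_(b <- words J L.+1) `|h b| ^+ 2) ->
  (joint_numrad dot X <= M%:E)%E.
Proof.
move=> M0 hM; apply: ge_ereal_sup => _ [h /= h1 <-].
rewrite lee_fin le_rnorm; apply: norm_sum_le; first by rewrite lecR.
move=> L; apply: (le_trans (hM h L)).
rewrite -[leRHS]mulr1 ler_wpM2l ?lecR//.
have -> : \sum_(b <- words J L.+1) `|h b| ^+ 2 =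
    (\sum_(b <- words J L.+1) rnorm (h b) ^+ 2)%:C%C.
  by rewrite [RHS]rmorph_sum/=; apply: eq_bigr => b _; rewrite rnormE rmorphXn.
rewrite -[1]/(1%:C%C) lecR -lee_fin -h1.
apply: esum_ge; exists [set` words J L.+1]; first by split => //; exact: finite_seq.
by rewrite -fsbig_seq ?words_uniq// sumEFin.
Qed.

End numerical_radius_bound.

(** * Inner product inequalities and identities *)

Section inner_product.
Variables (R : realType) (H : normedModType R[i]).
Variables (dot : {dot H for Num.conj}) (dotE : induces_norm dot).

Lemma dot_amgm (t : R[i]) u v : 0 < t ->
  2 * `|dot u v| <= t * `|u| ^+ 2 + t^-1 * `|v| ^+ 2.
Proof.
move=> t0; rewrite !dotE; apply: psd_form_amgm => //.
- by move=> w a x y; exact: linearPl.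
- exact: dotC.
Qed.

Lemma cauchy_schwarz u v : `|dot u v| <= `|u| * `|v|.
Proof.
have [->|u0] := eqVneq u 0; first by rewrite linear0l !normr0 mul0r.
have [->|v0] := eqVneq v 0; first by rewrite linear0r !normr0 mulr0.
have nu : `|u| != 0 by rewrite normr_eq0.
have nv : `|v| != 0 by rewrite normr_eq0.
(* This weight makes both terms of the inequality equal to the product of the norms. *)
have t0 : 0 < `|v| / `|u| by rewrite divr_gt0 ?normr_gt0.
rewrite -(ler_pM2l (ltr0n _ 2)); apply: (le_trans (dot_amgm u v t0)).
rewrite le_eqVlt; apply/orP; left; apply/eqP; field.
by rewrite nu nv.
Qed.

Lemma Re_le_norm (z : R[i]) : (complex.Re z)%:C%C <= `|z|.
Proof.
case: z => a b; rewrite normc_def lecR /=; apply: le_trans (ler_norm a) _.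
by rewrite -sqrtr_sqr ler_wsqrtr// lerDl sqr_ge0.
Qed.

Lemma ReD (y z : R[i]) : complex.Re (y + z) = complex.Re y + complex.Re z.
Proof. by case: y z => ? ? []. Qed.

Lemma ReN (z : R[i]) : complex.Re (- z) = - complex.Re z.
Proof. by case: z. Qed.

Lemma ReM (a : R) (z : R[i]) : complex.Re (a%:C%C * z) = a * complex.Re z.
Proof. by case: z => ? ? /=; rewrite mul0r subr0. Qed.

Lemma rnorm_sqrE u : rnorm u ^+ 2 = complex.Re (dot u u).
Proof. by rewrite -dotE rnormE -rmorphXn. Qed.

Lemma rnorm_sqrD u v :
  rnorm (u + v) ^+ 2 = rnorm u ^+ 2 + rnorm v ^+ 2 + 2 * complex.Re (dot u v).
Proof.
rewrite !rnorm_sqrE dnormD !ReD; case: (dot u v) => a b /=.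
by rewrite mulr_natl mulr2n.
Qed.

Lemma rnorm_sqrB u v :
  rnorm (u - v) ^+ 2 = rnorm u ^+ 2 + rnorm v ^+ 2 - 2 * complex.Re (dot u v).
Proof.
rewrite rnorm_sqrD linearNr /= /rnorm normrN.
by case: (dot u v) => a b /=; rewrite mulrN.
Qed.

Lemma Re_dotC u v : complex.Re (dot u v) = complex.Re (dot v u).
Proof. by rewrite dotC; case: (dot v u). Qed.

End inner_product.

(** * The Riesz representation theorem *)

Section riesz.
Variables (R : realType) (H : completeNormedModType R[i]).
Variables (dot : {dot H for Num.conj}) (dotE : induces_norm dot).
Variables (f : H -> R[i]) (M : R).
Hypotheses (f_linear : scalar f) (f_bnd : forall x, `|f x| <= M%:C%C * `|x|).

(** If [z] represents [f], this equals [rnorm (x - z) ^+ 2 - rnorm z ^+ 2]; so the representing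
    vector is sought by minimizing [phi]. *)
Let phi (x : H) : R := rnorm x ^+ 2 - 2 * complex.Re (f x).

Let fD x y : f (x + y) = f x + f y.
Proof. by rewrite -[x]scale1r f_linear mul1r scale1r. Qed.

Let fZ a x : f (a *: x) = a * f x.
Proof.
have f0 : f 0 = 0.
  by apply: (addrI (f 0)); rewrite -fD !addr0.
by rewrite -[a *: x]addr0 f_linear f0 addr0.
Qed.

Let phi_ge x : - M ^+ 2 <= phi x.
Proof.
have Rf : complex.Re (f x) <= M * rnorm x.
  rewrite -lecR; apply: le_trans (Re_le_norm _) _.
  by apply: le_trans (f_bnd x) _; rewrite rnormE rmorphM.
rewrite /phi; have := sqr_ge0 (rnorm x - M); rewrite sqrrB; lra.
Qed.

Let phi_inf := inf (range phi).

Let phi_has_inf : has_inf (range phi).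
Proof.
split; first by exists (phi 0); exists 0.
by exists (- M ^+ 2) => _ [x _ <-].
Qed.

Let phi_inf_le x : phi_inf <= phi x.
Proof. by apply: ge_inf; [case: phi_has_inf|exists x]. Qed.

(** Parallelogram law, with [phi] at the midpoint bounded below by its infimum: vectors that nearly
    minimize [phi] are close to each other. *)
Let phi_parallelogram x y :
  rnorm (x - y) ^+ 2 <= 2 * (phi x - phi_inf) + 2 * (phi y - phi_inf).
Proof.
have := phi_inf_le (2^-1 *: (x + y)).
have Hn : rnorm (2^-1 *: (x + y)) = 2^-1 * rnorm (x + y).
  apply: complexI; rewrite rmorphM /= -!rnormE normrZ ger0_norm ?invr_ge0 ?ler0n//.
  by rewrite fmorphV rmorph_nat.
have Hf : complex.Re (f (2^-1 *: (x + y))) =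
    2^-1 * (complex.Re (f x) + complex.Re (f y)).
  by rewrite fZ fD -ReD -ReM fmorphV rmorph_nat.
rewrite {1}/phi Hn Hf.
have := rnorm_sqrD dotE x y; have := rnorm_sqrB dotE x y; rewrite /phi.
by nra.
Qed.

Lemma riesz_representation : exists z, forall x, f x = dot x z.
Proof.
have /choice[u uP] : forall n : nat, exists x, phi x < phi_inf + n.+1%:R^-1.
  move=> n; have n0 : 0 < n.+1%:R^-1 :> R by rewrite invr_gt0 ltr0n.
  have [_ [x _ <-] xn] := inf_adherent n0 phi_has_inf.
  by exists x.
have u_dist m n : rnorm (u m - u n) ^+ 2 <= 2 * m.+1%:R^-1 + 2 * n.+1%:R^-1.
  have := phi_parallelogram (u m) (u n); have := uP m; have := uP n.
  by move: (m.+1%:R^-1) (n.+1%:R^-1) => a b; lra.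
have /cauchy_cvg uz : cauchy (u @ \oo).
  apply: cauchy_exP => e e0.
  have ee : (complex.Re e)%:C%C = e by rewrite RRe_real ?gtr0_real.
  have e'0 : 0 < complex.Re e by rewrite -ltcR ee.
  have e4 : 0 < complex.Re e ^+ 2 / 4 by rewrite divr_gt0 ?exprn_gt0 ?ltr0n.
  have [N _ hN] := near_infty_natSinv_lt (PosNum e4).
  exists (u N), N => // n /= Nn.
  rewrite -ball_normE /= rnormE -ee ltcR -(@ltr_pXn2r _ 2)// ?nnegrE ?rnorm_ge0 ?ltW//.
  apply: (le_lt_trans (u_dist N n)).
  have := hN N (leqnn N); have := hN n Nn => /=.
  by move: (N.+1%:R^-1) (n.+1%:R^-1) => a b; lra.
pose z := lim (u @ \oo); exists z => v.
(* Compare [phi (u n + w)] with the almost minimal [phi (u n)], and replace [u n] by [z] using that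
   the square of the norm of [w + (z - u n)] is nonnegative. *)
have g_le w : complex.Re (f w - dot w z) <= rnorm w ^+ 2.
  apply/ler_addgt0Pr => e e0.
  have se0 : (0 : R[i]) < (Num.sqrt e)%:C%C by rewrite ltcR sqrtr_gt0.
  have [n [ne zn]] : exists n, n.+1%:R^-1 < e /\ rnorm (z - u n) ^+ 2 < e.
    near \oo => n; exists n; split.
      by near: n; exact: near_infty_natSinv_lt (PosNum e0).
    rewrite -[ltRHS](sqr_sqrtr (ltW e0)) ltr_pXn2r// ?nnegrE ?rnorm_ge0 ?sqrtr_ge0//.
    rewrite -ltcR -rnormE.
    by near: n; move/cvgr_dist_lt : uz; apply.
  have := phi_inf_le (u n + w); have := uP n.
  have := sqr_ge0 (rnorm (w + (z - u n))).
  rewrite (rnorm_sqrD dotE w) /phi (rnorm_sqrD dotE (u n)) fD linearBr /= !ReD !ReN.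
  rewrite (Re_dotC dot (u n)) /=.
  move: (n.+1%:R^-1) ne => a ne.
  by lra.
apply/eqP; rewrite -subr_eq0; apply/negPn/negP => g0.
set g := f v - dot v z in g0.
pose N := complex.Re `|g|.
have NE : `|g| = N%:C%C by rewrite RRe_real// normr_real.
have N0 : 0 < N by rewrite -ltcR -NE normr_gt0.
(* At [w = a *: v] the inequality reads [t * N ^+ 2 <= (t * N * rnorm v) ^+ 2]. Since
   [1 - t * rnorm v ^+ 2 = t], this choice gives [t ^+ 2 * N ^+ 2 <= 0], a contradiction. *)
pose t := (1 + rnorm v ^+ 2)^-1.
have d0 : 0 < 1 + rnorm v ^+ 2 by rewrite ltr_wpDr// sqr_ge0.
have t0 : 0 < t by rewrite invr_gt0.
pose a := t%:C%C * g^*.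
have := g_le (a *: v).
have -> : f (a *: v) - dot (a *: v) z = t%:C%C * (N ^+ 2)%:C%C.
  rewrite fZ linearZl_LR/= -mulrBr -/g /a -mulrA [g^* * g]mulrC -normCK NE.
  by rewrite rmorphXn.
have -> : rnorm (a *: v) = t * N * rnorm v.
  apply: complexI; rewrite -rnormE normrZ /a normrM norm_conjC NE.
  by rewrite ger0_norm ?lecR ?ltW// rnormE !rmorphM.
rewrite ReM /= => h.
have tE : t * (1 + rnorm v ^+ 2) = 1 by rewrite mulVf// gt_eqF.
have : t * N ^+ 2 * (1 - t * rnorm v ^+ 2) <= 0.
  by rewrite mulrBr mulr1 subr_le0; move: h; rewrite !exprMn expr2; lra.
have -> : 1 - t * rnorm v ^+ 2 = t by rewrite -tE; ring.
by rewrite leNgt !mulr_gt0// exprn_gt0.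
Unshelve. all: by end_near. Qed.

End riesz.

(** * Adjoints and the norm of a row of operators *)

Section adjoint.
Variables (R : realType) (H : completeNormedModType R[i]).
Variables (dot : {dot H for Num.conj}) (dotE : induces_norm dot).

Lemma bounded_op_bound (A : {linear H -> H}) : bounded_op A ->
  exists2 M : R, 0 <= M & forall x, `|A x| <= M%:C%C * `|x|.
Proof.
move=> /linear_boundedP/pinfty_ex_gt0[M M0 AM].
have ME : (complex.Re M)%:C%C = M by rewrite RRe_real ?gtr0_real.
by exists (complex.Re M); [rewrite -lecR ME ltW|rewrite ME].
Qed.

Lemma dot_inj u v : (forall x, dot x u = dot x v) -> u = v.
Proof.
move=> uv; apply/eqP; rewrite -subr_eq0 -normr_eq0 -sqrf_eq0 dotE.
by rewrite linearBr /= uv subrr.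
Qed.

Lemma adjointP (A : {linear H -> H}) x y : bounded_op A ->
  dot (A x) y = dot x (adjoint dot A y).
Proof.
move=> /bounded_op_bound[M M0 AM]; rewrite /adjoint.
(* [adjoint] is chosen by [get], which is meaningful once the Riesz theorem shows that a
   representing vector exists. *)
have [z zP] : exists z, forall x, dot (A x) y = dot x z.
  apply: (riesz_representation dotE (M := M * rnorm y)).
  - by move=> a u v; rewrite linearP linearPl.
  - move=> u; apply: le_trans (cauchy_schwarz dotE _ _) _.
    by rewrite rmorphM/= -rnormE mulrAC ler_wpM2r.
by have /getPex/= := ex_intro [set z | forall x, dot (A x) y = dot x z] z zP; apply.
Qed.

Lemma adjointZ (A : {linear H -> H}) a y : bounded_op A ->
  adjoint dot A (a *: y) = a *: adjoint dot A y.
Proof.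
by move=> Ab; apply: dot_inj => x; rewrite -adjointP// !linearZr_LR/= -adjointP.
Qed.

(** With [z] the adjoint applied to [y], the square of the norm of [z] is [dot (A z) y]; apply
    Cauchy-Schwarz and cancel one factor. *)
Lemma adjoint_le (A : {linear H -> H}) (M : R) y : bounded_op A -> 0 <= M ->
  (forall x, `|A x| <= M%:C%C * `|x|) ->
  `|adjoint dot A y| <= M%:C%C * `|y|.
Proof.
move=> Ab M0 AM; set z := adjoint dot A y.
have [->|z0] := eqVneq z 0; first by rewrite normr0 mulr_ge0// lecR.
rewrite -(@ler_pM2l _ `|z|) ?normr_gt0//.
have := cauchy_schwarz dotE (A z) y.
rewrite adjointP// -dotE normrX normr_id expr2 => /le_trans; apply.
by rewrite mulrCA mulrA ler_wpM2r// mulrC.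
Qed.

Variables (n : nat) (T : 'I_n -> {linear H -> H}).
Hypothesis Tbounded : forall i, bounded_op (T i).

Lemma dot_row_square y :
  dot (row_square dot T y) y = \sum_i `|adjoint dot (T i) y| ^+ 2.
Proof.
rewrite /row_square linear_sumlz/=; apply: eq_bigr => i _.
by rewrite (adjointP _ _ (Tbounded i)) dotE.
Qed.

Lemma row_squareZ a y : row_square dot T (a *: y) = a *: row_square dot T y.
Proof.
by rewrite scaler_sumr; apply: eq_bigr => i _; rewrite adjointZ// linearZ.
Qed.

Lemma row_square_opnorm y :
  `|row_square dot T y| <= (opnorm (row_square dot T))%:C%C * `|y|.
Proof.
have /choice[M MP] : forall i, exists M : R, 0 <= M /\
    forall x, `|T i x| <= M%:C%C * `|x|.
  by move=> i; have [M] := bounded_op_bound (Tbounded i); exists M.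
(* This crude bound shows that the set in [opnorm] is bounded above, so that its [sup] is a true
   upper bound. *)
have S_le x : `|row_square dot T x| <= (\sum_i M i ^+ 2)%:C%C * `|x|.
  rewrite rmorph_sum mulr_suml; apply: le_trans (ler_norm_sum _ _ _) _.
  apply: ler_sum => i _; have [M0 TM] := MP i; apply: le_trans (TM _) _.
  rewrite rmorphXn/= expr2 -mulrA ler_wpM2l ?lecR//.
  exact: adjoint_le.
have [->|y0] := eqVneq y 0.
  by apply: le_trans (S_le 0) _; rewrite normr0 !mulr0.
have ny : `|y| != 0 by rewrite normr_eq0.
have {1}-> : y = `|y| *: (`|y|^-1 *: y) by rewrite scalerA divff// scale1r.
rewrite row_squareZ normrZ normr_id mulrC ler_wpM2r// -le_rnorm.
have y1 : `| `|y|^-1 *: y| <= 1.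
  by rewrite normrZ ger0_norm ?invr_ge0// mulVf.
apply: ub_le_sup; last by exists (`|y|^-1 *: y).
exists (\sum_i M i ^+ 2) => _ [x /= x1 <-]; rewrite le_rnorm.
apply: le_trans (S_le x) _; rewrite -[leRHS]mulr1 ler_wpM2l// lecR.
by apply: sumr_ge0 => i _; exact: sqr_ge0.
Qed.

Lemma opnorm_ge0 (A : H -> H) : 0 <= opnorm A.
Proof.
rewrite /opnorm; set S := (X in sup X).
have [[bS]|nb] := pselect (has_ubound S).
  move=> bP; apply: le_trans (rnorm_ge0 (A 0)) _; apply: ub_le_sup => //.
  by exists bS.
  by exists 0; rewrite //= normr0.
(* The [sup] of an unbounded set is 0 by default. *)
rewrite sup_out//; exact: (fun h => nb h.2).
Qed.

Lemma sum_adjoint_le y : \sum_i `|adjoint dot (T i) y| ^+ 2 <=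
  (opnorm (row_square dot T))%:C%C * `|y| ^+ 2.
Proof.
rewrite -dot_row_square.
have : `|dot (row_square dot T y) y| <=
    (opnorm (row_square dot T))%:C%C * `|y| ^+ 2.
  apply: le_trans (cauchy_schwarz dotE _ _) _.
  by rewrite expr2 mulrA ler_wpM2r// row_square_opnorm.
by rewrite ger0_norm// dot_row_square sumr_ge0// => i _; rewrite exprn_ge0.
Qed.

(** Duality between the row and the column of adjoints: write the square of the norm of [y] as a sum
    of terms [dot (g i) (adjoint dot (T i) y)], apply the weighted inequality with weight [c], and
    absorb the part in [y]. *)
Lemma row_bounded (c : R[i]) : 0 <= c ->
  (forall y, \sum_i `|adjoint dot (T i) y| ^+ 2 <= c * `|y| ^+ 2) ->
  forall g : 'I_n -> H,
  `|\sum_i T i (g i)| ^+ 2 <= c * \sum_i `|g i| ^+ 2.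
Proof.
move=> c0 cP g; set y := \sum_i T i (g i).
have yE : `|y| ^+ 2 = \sum_i dot (g i) (adjoint dot (T i) y).
  rewrite dotE {1}/y linear_sumlz/=; apply: eq_bigr => i _.
  by rewrite (adjointP _ _ (Tbounded i)).
(* The weight [c] must be positive; for [c = 0] all adjoints vanish at [y]. *)
have [c_0|cn0] := eqVneq c 0.
  rewrite c_0 mul0r yE big1// => i _.
  have : `|adjoint dot (T i) y| ^+ 2 <= 0.
    have := cP y; rewrite c_0 mul0r; apply: le_trans.
    by rewrite (bigD1 i)//= lerDl sumr_ge0// => j _; rewrite exprn_ge0.
  rewrite le_eqVlt (le_gtF (exprn_ge0 _ (normr_ge0 _))) orbF expf_eq0/=.
  by rewrite normr_eq0 => /eqP ->; rewrite linear0r.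
have cgt0 : 0 < c by rewrite lt_def cn0.
have : 2 * `|y| ^+ 2 <= c * (\sum_i `|g i| ^+ 2) + `|y| ^+ 2.
  have -> : 2 * `|y| ^+ 2 = `|2 * `|y| ^+ 2|.
    by rewrite ger0_norm// mulr_ge0 ?ler0n// exprn_ge0.
  rewrite {1}yE normrM ger0_norm ?ler0n//.
  apply: (@le_trans _ _ (\sum_i (c * `|g i| ^+ 2 +
      c^-1 * `|adjoint dot (T i) y| ^+ 2))).
    apply: (@le_trans _ _ (\sum_i 2 * `|dot (g i) (adjoint dot (T i) y)|)).
      by rewrite -mulr_sumr ler_wpM2l ?ler0n// ler_norm_sum.
    by apply: ler_sum => i _; exact: dot_amgm.
  rewrite big_split/= -!mulr_sumr lerD2l -(ler_pM2l cgt0) mulVKf//.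
by rewrite mulr_natl mulr2n lerD2r.
Qed.

End adjoint.

(** * Nilpotent tuples: words of fixed length and homogeneous operators *)

Lemma big_tuple_cons (I : finType) (V : nmodType) k (F : k.+1.-tuple I -> V) :
  \sum_(w : k.+1.-tuple I) F w =
  \sum_i \sum_(w : k.-tuple I) F [tuple of i :: w].
Proof.
rewrite pair_bigA/= (reindex (fun p : I * k.-tuple I => [tuple of p.1 :: p.2]))//=.
exists (fun w => (thead w, [tuple of behead w])) => [[i w] _|w _]/=.
  by congr pair; apply: val_inj.
by rewrite -tuple_eta.
Qed.

Section nilpotent_tuples.
Variables (R : realType) (H : normedModType R[i]).
Variables (dot : {dot H for Num.conj}) (dotE : induces_norm dot).

Lemma row_numrad_cos (J : finType) (X : J -> {linear H -> H}) (r : R) N L h :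
  0 <= r ->
  (forall g : J -> H,
    `|\sum_j X j (g j)| ^+ 2 <= r%:C%C ^+ 2 * \sum_j `|g j| ^+ 2) ->
  (forall w : seq J, size w = N.+1 -> forall x, word_op X w x = 0) ->
  `|\sum_(b <- words J L) \sum_j dot (h b) (X j (h (j :: b)))| <=
  (r * cos (pi / (N + 2)%:R))%:C%C * \sum_(b <- words J L.+1) `|h b| ^+ 2.
Proof.
move=> r0 Xr Xnil; pose t : R := pi / (N + 2)%:R.
have t0 : 0 < t by rewrite divr_gt0 ?pi_gt0// ltr0n addn2.
have tN : t * N.+2%:R = pi by rewrite /t addn2 divfK// pnatr_eq0.
(* Products of [N.+1] entries vanish, so the path has [N.+1] vertices. This [s] is zero at [0] and
   [N.+2], positive in between, and its recurrence is [sin (x - t) + sin (x + t) = 2 * cos t * sin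
   x]. *)
pose s j : R[i] := (sin (t * j%:R))%:C%C.
rewrite rmorphM/=; apply: (row_numrad_nilpotent dotE _ Xr (s := s) (N := N)) => //.
- by rewrite lecR.
- by rewrite /s mulr0 sin0.
- by rewrite /s tN sinpi.
- move=> j jN; rewrite ltcR sin_gt0_pi// mulr_gt0 ?ltr0n//= -tN ltr_pM2l// ltr_nat.
  by rewrite ltnS.
move=> j _; rewrite /s -rmorphD -(rmorph_nat (real_complex R) 2) -!rmorphM.
congr (_%:C%C).
have -> : t * j%:R = t * j.+1%:R - t by rewrite -natr1; ring.
have -> : t * j.+2%:R = t * j.+1%:R + t by rewrite -[in LHS]natr1; ring.
by rewrite sinB sinD -/t; ring.
Qed.

Variables (n m : nat) (T : 'I_n -> {linear H -> H}).
Hypothesis Tnil : forall w : seq 'I_n, size w = m -> forall x, word_op T w x = 0.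

Lemma word_op_eq0 (w : seq 'I_n) x : (m <= size w)%N -> word_op T w x = 0.
Proof.
move=> mw; rewrite -(cat_take_drop m w) word_op_cat Tnil// size_take.
by case: ltngtP mw.
Qed.

(** A product of entries of the tuple of all [T_w] with [w] of length [k] is again a word in [T], so
    that the nilpotency of [T] passes to this tuple. *)
Lemma word_op_flatten k (v : seq (k.-tuple 'I_n)) x :
  word_op (fun w : k.-tuple 'I_n => word_op T w : {linear H -> H}) v x =
  word_op T (flatten (map val v)) x.
Proof.
elim: v => //= w v IH; rewrite word_op_cat -IH.
by [].
Qed.

Lemma size_flatten_tuples k (v : seq (k.-tuple 'I_n)) :
  size (flatten (map val v)) = (size v * k)%N.
Proof. by elim: v => //= w v IH; rewrite size_cat size_tuple IH mulSn. Qed.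

(** Peeling off the first letter writes the row of words of length [k.+1] as the row [T] applied to
    rows of words of length [k]; each letter costs a factor [c]. *)
Lemma word_row_bounded (c : R[i]) : 0 <= c ->
  (forall g : 'I_n -> H, `|\sum_i T i (g i)| ^+ 2 <= c * \sum_i `|g i| ^+ 2) ->
  forall k (g : k.-tuple 'I_n -> H),
  `|\sum_(w : k.-tuple 'I_n) word_op T w (g w)| ^+ 2 <=
  c ^+ k * \sum_(w : k.-tuple 'I_n) `|g w| ^+ 2.
Proof.
move=> c0 Tc; elim=> [|k IH] g.
  have E (V : nmodType) (F : 0.-tuple 'I_n -> V) : \sum_w F w = F [tuple].
    by rewrite (big_pred1 [tuple])// => w; apply/esym/eqP; exact: tuple0.
  by rewrite expr0 mul1r !E.
rewrite !big_tuple_cons.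
have -> : \sum_i \sum_(w : k.-tuple 'I_n)
      word_op T [tuple of i :: w] (g [tuple of i :: w]) =
    \sum_i T i (\sum_(w : k.-tuple 'I_n) word_op T w (g [tuple of i :: w])).
  by apply: eq_bigr => i _; rewrite linear_sum.
apply: le_trans (Tc _) _; rewrite exprS -mulrA ler_wpM2l// mulr_sumr.
by apply: ler_sum => i _; exact: IH.
Qed.

Definition homogeneous_op (a : seq 'I_n -> R[i]) k (x : H) : H :=
  \sum_(w : k.-tuple 'I_n) a w *: word_op T w x.

Lemma homogeneous_op_is_linear a k : linear (homogeneous_op a k).
Proof.
move=> c x y; rewrite /homogeneous_op scaler_sumr -big_split/=.
by apply: eq_bigr => w _; rewrite linearP scalerDr !scalerA mulrC.
Qed.

HB.instance Definition _ a k :=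
  GRing.isLinear.Build _ _ _ _ (homogeneous_op a k) (homogeneous_op_is_linear a k).

(** The prefix [u] collects the letters already expanded, each factor adding [k] of them. The index
    type ['I_1] is that of [numrad]. *)
Lemma word_op_homogeneous_eq0 a k (v : seq 'I_1) (u : seq 'I_n) x :
  (m <= size u + size v * k)%N ->
  word_op T u (word_op (fun=> homogeneous_op a k : {linear H -> H}) v x) = 0.
Proof.
elim: v u => [|i v IH] u /=; first by rewrite addn0; exact: word_op_eq0.
move=> mv; rewrite /homogeneous_op linear_sum big1// => w _.
rewrite linearZ/= -word_op_cat IH ?scaler0//.
by rewrite size_cat size_tuple -addnA -mulSn.
Qed.

Definition homogeneous_norm (a : seq 'I_n -> R[i]) k : R :=
  Num.sqrt (\sum_(w : k.-tuple 'I_n) rnorm (a w : R[i]^o) ^+ 2).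

(** The operator is the contractive row of all [T_w], with [w] of length [k], applied to the column
    of the vectors [a w *: x]. *)
Lemma homogeneous_op_bounded a k
    (Trow : forall g : 'I_n -> H,
      `|\sum_i T i (g i)| ^+ 2 <= 1 * \sum_i `|g i| ^+ 2) (g : 'I_1 -> H) :
  `|\sum_j homogeneous_op a k (g j)| ^+ 2 <=
  (homogeneous_norm a k)%:C%C ^+ 2 * \sum_j `|g j| ^+ 2.
Proof.
rewrite !big_ord1; set x := g ord0.
have := word_row_bounded ler01 Trow (fun w : k.-tuple 'I_n => a w *: x).
rewrite expr1n mul1r /homogeneous_op.
under eq_bigr do rewrite linearZ.
move=> /le_trans; apply.
rewrite -rmorphXn sqr_sqrtr ?sumr_ge0// => [|w _]; last exact: sqr_ge0.
rewrite rmorph_sum mulr_suml; apply: ler_sum => w _.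
by rewrite normrZ exprMn (rnormE (a w : R[i]^o)) rmorphXn.
Qed.

Lemma homogeneous_numrad a k L h
    (Trow : forall g : 'I_n -> H,
      `|\sum_i T i (g i)| ^+ 2 <= 1 * \sum_i `|g i| ^+ 2) :
  `|\sum_(b <- words 'I_1 L) \sum_j dot (h b) (homogeneous_op a k (h (j :: b)))|
  <= (homogeneous_norm a k * (if k == 0%N then 1 else cosk R m k))%:C%C *
     \sum_(b <- words 'I_1 L.+1) `|h b| ^+ 2.
Proof.
have a0 : 0 <= homogeneous_norm a k by exact: sqrtr_ge0.
have Ab := homogeneous_op_bounded a k Trow.
pose X : 'I_1 -> {linear H -> H} := fun=> homogeneous_op a k.
(* The part of degree 0 is a scalar, to which nilpotency does not apply; the norm bound alone gives
   the factor 1. *)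
case: eqVneq => [_|k0].
  by rewrite mulr1; apply: (row_numrad dotE (X := X) _ Ab); rewrite lecR.
apply: (row_numrad_cos (X := X)) => // w sw x.
apply: (word_op_homogeneous_eq0 _ (u := [::])).
rewrite add0n sw.
(* A product of [((m - 1) %/ k).+1] factors of degree [k] has degree at least [m], which accounts
   for the [+ 2] in [cosk]. *)
have : (m - 1 < ((m - 1) %/ k).+1 * k)%N by rewrite ltn_ceil// lt0n.
by case: m => // m'; rewrite subn1.
Qed.

End nilpotent_tuples.

(** * Real Cauchy-Schwarz and the homogeneous decomposition of a polynomial *)

Lemma sum_mul_le (R : rcfType) (I : finType) (a b : I -> R) :
  \sum_i a i * b i <= Num.sqrt (\sum_i a i ^+ 2) * Num.sqrt (\sum_i b i ^+ 2).
Proof.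
set A := \sum_i a i ^+ 2; set B := \sum_i b i ^+ 2; set P := \sum_i _.
have A0 : 0 <= A by apply: sumr_ge0 => i _; exact: sqr_ge0.
have PAB : P ^+ 2 <= A * B.
  (* Lagrange's identity: this double sum is twice the Cauchy-Schwarz defect. *)
  have : 0 <= \sum_i \sum_j (a i * b j - a j * b i) ^+ 2.
    by apply: sumr_ge0 => i _; apply: sumr_ge0 => j _; exact: sqr_ge0.
  have -> : \sum_i \sum_j (a i * b j - a j * b i) ^+ 2 = 2 * (A * B - P ^+ 2).
    under eq_bigr => i _.
      under eq_bigr => j _.
        rewrite (_ : _ ^+ 2 = a i ^+ 2 * b j ^+ 2 + b i ^+ 2 * a j ^+ 2
          - 2 * ((a i * b i) * (a j * b j))); last by ring.
        over.
      rewrite sumrB big_split/= -!mulr_sumr.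
      over.
    rewrite sumrB big_split/= -mulr_sumr -!mulr_suml.
    rewrite -/A -/B -/P; ring.
  by rewrite pmulr_rge0 ?ltr0n// subr_ge0.
rewrite -sqrtrM// (le_trans (ler_norm P))// -sqrtr_sqr ler_wsqrtr//.
Qed.

Section polynomials.
Variables (R : realType) (H : normedModType R[i]).
Variables (n m : nat) (p : fock_poly R n).
Hypothesis p_deg : forall w, w \in finsupp p -> (size w < m)%N.

(** The support is grouped by length; as [F] vanishes off it, each inner sum may run over all words
    of that length. *)
Lemma sum_finsupp_homogeneous (V : nmodType) (F : seq 'I_n -> V) :
  (forall w, w \notin finsupp p -> F w = 0) ->
  \sum_(w <- finsupp p) F w = \sum_(k < m) \sum_(w : k.-tuple 'I_n) F w.
Proof.
move=> F0.
transitivity (\sum_(w <- finsupp p) \sum_(k < m | k == size w :> nat) F w).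
  apply: eq_big_seq => w wp.
  by rewrite (big_pred1 (Ordinal (p_deg wp))).
rewrite (exchange_big_dep predT)//=; apply: eq_bigr => k _.
transitivity (\sum_(w <- finsupp p | size w == k) F w).
  by apply: eq_bigl => w; rewrite eq_sym.
pose s := [seq val w | w <- enum {: k.-tuple 'I_n}].
have -> : \sum_(w : k.-tuple 'I_n) F w = \sum_(w <- s) F w.
  by rewrite big_map big_enum.
rewrite -big_filter (bigID (fun w => w \in finsupp p)).
rewrite [RHS](bigID (fun w => w \in finsupp p))/=.
rewrite [X in _ + X = _]big1 => [|w /F0//].
rewrite [X in _ = _ + X]big1 => [|w /F0//].
rewrite !addr0 -big_filter -[RHS]big_filter; apply: perm_big.
apply: uniq_perm => [||w].
- by rewrite !filter_uniq// fset_uniq.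
- by rewrite filter_uniq// map_inj_uniq ?enum_uniq//; exact: val_inj.
rewrite !mem_filter; case: (boolP (w \in finsupp p)) => //= wp.
rewrite andbT; apply/eqP/mapP => [sw|[t _ ->]]; last by rewrite size_tuple.
by exists (Tuple (introT eqP sw)); rewrite ?mem_enum.
Qed.

Lemma poly_op_homogeneous (T : 'I_n -> {linear H -> H}) x :
  poly_op p T x = \sum_(k < m) homogeneous_op T p k x.
Proof.
rewrite /poly_op (sum_finsupp_homogeneous (F := fun w => p w *: word_op T w x))//.
by move=> w /fsfun_dflt ->; rewrite scale0r.
Qed.

Lemma poly_norm2_homogeneous :
  poly_norm2 p = Num.sqrt (\sum_(k < m) homogeneous_norm p k ^+ 2).
Proof.
rewrite /poly_norm2 (sum_finsupp_homogeneous (F := fun w => rnorm (p w : R[i]^o) ^+ 2)).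
  congr Num.sqrt; apply: eq_bigr => k _; rewrite sqr_sqrtr//.
  by apply: sumr_ge0 => w _; exact: sqr_ge0.
by move=> w /fsfun_dflt ->; rewrite /rnorm normr0 expr0n.
Qed.

End polynomials.

Theorem corollary7p7 (R : realType) (H : completeNormedModType R[i])
    (dot : {dot H for Num.conj}) (dotE : induces_norm dot)
    (n m : nat) (n_ge1 : (1 <= n)%N) (m_ge2 : (2 <= m)%N)
    (T : 'I_n -> {linear H -> H}) (Tbounded : forall i, bounded_op (T i))
    (Tnil : forall w : seq 'I_n, size w = m -> forall x, word_op T w x = 0) :
  (forall k : nat, (1 <= k <= m - 1)%N ->
     (joint_numrad dot (fun w : k.-tuple 'I_n => word_op T w)
        <= (opnorm (row_square dot T) `^ (k%:R / 2) * cosk R m k)%:E)%E)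
  /\ (row_contraction dot T ->
      forall p : fock_poly R n,
        (forall w, w \in finsupp p -> (size w <= m - 1)%N) ->
        (numrad dot (poly_op p T) <= (constK R m * poly_norm2 p)%:E)%E).
Proof.
have mE : (m - 1).+1 = m by rewrite subn1 prednK// ltnW.
split=> [k /andP[k1 km]|Trow p p_deg].
  set c := opnorm (row_square dot T).
  have c0 : 0 <= c := opnorm_ge0 _.
  (* The row of all words of length [k] has squared bound [c ^+ k], so its bound is the half-integer
     power in the statement. *)
  have ckE : (c `^ (k%:R / 2))%:C%C ^+ 2 = c%:C%C ^+ k.
    rewrite -!rmorphXn -powR_mulrn ?powR_ge0// -powRrM divfK ?pnatr_eq0//.
    by rewrite powR_mulrn.
  have Tc : forall g : 'I_n -> H,
      `|\sum_i T i (g i)| ^+ 2 <= c%:C%C * \sum_i `|g i| ^+ 2.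
    by apply: (row_bounded dotE Tbounded); [rewrite lecR|exact: sum_adjoint_le].
  (* The angle is at most a right angle, so the claimed bound is nonnegative. *)
  have pi2 : pi / ((m - 1) %/ k + 2)%:R <= pi / 2 :> R.
    by rewrite ler_pM2l ?pi_gt0// lef_pV2 ?posrE ?ltr0n ?ler_nat// ?addn2// leq_addl.
  apply: joint_numrad_le => [|h L].
    rewrite mulr_ge0 ?powR_ge0// cos_ge0_pihalf// pi2 andbT.
    by rewrite (@le_trans _ _ 0) ?oppr_le0 ?divr_ge0 ?pi_ge0 ?ler0n.
  pose X w : {linear H -> H} := word_op T (w : k.-tuple 'I_n).
  apply: (row_numrad_cos dotE (X := X)) => [|g|v sv x]; first exact: powR_ge0.
    by rewrite ckE; apply: (word_row_bounded _ Tc); rewrite lecR.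
  rewrite word_op_flatten; apply: (word_op_eq0 Tnil).
  rewrite size_flatten_tuples sv.
  have : (m - 1 < ((m - 1) %/ k).+1 * k)%N by rewrite ltn_ceil.
  by rewrite mE.
have T1 : forall g : 'I_n -> H,
    `|\sum_i T i (g i)| ^+ 2 <= 1 * \sum_i `|g i| ^+ 2.
  apply: (row_bounded dotE Tbounded) => // y.
  by rewrite mul1r -(dot_row_square dotE Tbounded) dotE.
have p_deg' w : w \in finsupp p -> (size w < m)%N.
  by move=> /p_deg; rewrite -ltnS mE.
apply: joint_numrad_le => [|h L]; first by rewrite mulr_ge0 ?sqrtr_ge0.
have -> : \sum_(b <- words 'I_1 L) \sum_j dot (h b) (poly_op p T (h (j :: b))) =
    \sum_(k < m) \sum_(b <- words 'I_1 L)
      \sum_j dot (h b) (homogeneous_op T p k (h (j :: b))).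
  rewrite [RHS]exchange_big/=; apply: eq_bigr => b _.
  rewrite [RHS]exchange_big/=; apply: eq_bigr => j _.
  by rewrite (poly_op_homogeneous p_deg') linear_sumr.
apply: le_trans (ler_norm_sum _ _ _) _.
apply: (@le_trans _ _ (\sum_(k < m)
    (homogeneous_norm p k * (if k == 0%N :> nat then 1 else cosk R m k))%:C%C *
    \sum_(b <- words 'I_1 L.+1) `|h b| ^+ 2)).
  by apply: ler_sum => k _; apply: homogeneous_numrad.
rewrite -mulr_suml -rmorph_sum/= ler_wpM2r//.
  by apply: sumr_ge0 => b _; exact: exprn_ge0.
rewrite lecR (poly_norm2_homogeneous p_deg') mulrC.
(* Cauchy-Schwarz over the degrees separates the cosine factors from the norms of the homogeneous
   parts. *)
apply: le_trans (sum_mul_le _ _) _; rewrite /constK big_mkord.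
rewrite le_eqVlt; apply/orP; left; apply/eqP; congr (_ * Num.sqrt _).
by apply: eq_bigr => k _; case: ifP; rewrite ?expr1n.
Qed.
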